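(* Let $p$ be a prime, let $a,b,c\in\mathbb{Q}_p$ with $a\neq c$ and $c^2-ac+b\neq 0$, let $f(x)=\frac{x^2+ax+b}{x+c}$ for $x\in\mathbb{Q}_p$, $x\neq -c$, let $x_0=\frac{b}{c-a}$ be its unique fixed point, and put $\alpha=|x_0+a|_p$, $\beta=|x_0+c|_p$. Let $r>0$ be a value of the $p$-adic norm. Then the sphere $S_r(x_0)$ is invariant for $f$ if and only if $r\in I$.
   Context: Here $|\cdot|_p$ is the $p$-adic norm on $\mathbb{Q}_p$ normalized by $|p|_p=1/p$, and $S_r(x_0)=\{x\in\mathbb{Q}_p:|x-x_0|_p=r\}$. A (nonzero) value of the $p$-adic norm means a number of the form $p^k$, $k\in\mathbb{Z}$. A set $V$ is invariant for $f$ if $f(V)\subset V$ (i.e. $f(x)\in V$ for every $x\in V$ with $x\neq -c$). The set $I$ of positive reals is $I=I_1\cup I_2$, where $I_1=\{r: r>\max\{\alpha,\beta\}\}$ if $\alpha\neq\beta$ (and $I_1=\emptyset$ otherwise), and $I_2=\{r: r\neq\beta\}$ if $\alpha=\beta$ (and $I_2=\emptyset$ otherwise). *)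

(* Defs.v *)
From HB Require Import structures.
From mathcomp Require Import all_boot all_order all_algebra.
From mathcomp Require Import boolp classical_sets functions reals topology normedtype sequences.
From mathcomp Require Import ring lra.

Set Implicit Arguments.
Unset Strict Implicit.
Unset Printing Implicit Defensive.

Import Order.TTheory GRing.Theory Num.Theory.
Import numFieldNormedType.Exports.

Local Open Scope classical_set_scope.
Local Open Scope ring_scope.

(* |m / n|_p = p ^ (v_p(n) - v_p(m)).  When p is not prime, logn p = 0, so    *)
(* this is the trivial absolute value and Qp p below is just a copy of rat.   *)
Definition padic_abs (p : nat) (q : rat) : rat :=
  if q == 0 then 0
  else p%:R ^ ((logn p `|denq q|)%:Z - (logn p `|numq q|)%:Z).

Section PadicAbs.
Variable p : nat.
Local Notation "|< x >|" := (padic_abs p x) (at level 0, format "|< x >|").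

Lemma logn_nonprime (m : nat) : ~~ prime p -> logn p m = 0%N.
Proof. by move=> np; rewrite lognE (negbTE np). Qed.

Lemma padic_abs0 : |<0>| = 0. Proof. by rewrite /padic_abs eqxx. Qed.

Lemma padic_abs_gt0 x : x != 0 -> 0 < |<x>|.
Proof.
move=> x0; rewrite /padic_abs (negbTE x0).
have [pp|np] := boolP (prime p).
  by rewrite exprz_gt0 // ltr0n prime_gt0.
by rewrite !logn_nonprime // subrr expr0z.
Qed.

Lemma padic_abs_ge0 x : 0 <= |<x>|.
Proof.
by have [->|/padic_abs_gt0/ltW//] := eqVneq x 0; rewrite padic_abs0.
Qed.

Lemma padic_abs_eq0 x : (|<x>| == 0) = (x == 0).
Proof.
have [->|x0] := eqVneq x 0; first by rewrite padic_abs0 eqxx.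
by rewrite gt_eqF // padic_abs_gt0.
Qed.

Lemma padic_abs_frac (m n : int) : m != 0 -> n != 0 ->
  |<m%:Q / n%:Q>| = p%:R ^ ((logn p `|n|)%:Z - (logn p `|m|)%:Z).
Proof.
move=> m0 n0; have mq : m%:Q != 0 by rewrite intr_eq0.
have nq : n%:Q != 0 by rewrite intr_eq0.
have x0 : m%:Q / n%:Q != 0 by rewrite mulf_neq0 ?invr_eq0.
rewrite /padic_abs (negbTE x0); set x := _ / _.
have e : numq x * n = m * denq x.
  apply: (@intr_inj rat); rewrite !rmorphM /= numqE /x.
  by field; rewrite nq.
have {e} e : (`|numq x| * `|n| = `|m| * `|denq x|)%N by rewrite -!abszM e.
have := congr1 (logn p) e.
rewrite !lognM ?absz_gt0 ?denq_neq0 ?numq_eq0 // => el.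
congr (_ ^ _); apply/eqP; rewrite subr_eq addrAC eq_sym subr_eq.
by rewrite -!PoszD; apply/eqP; congr Posz; rewrite addnC el addnC.
Qed.

Lemma padic_absM x y : |<x * y>| = |<x>| * |<y>|.
Proof.
have [->|x0] := eqVneq x 0; first by rewrite mul0r padic_abs0 mul0r.
have [->|y0] := eqVneq y 0; first by rewrite mulr0 padic_abs0 mulr0.
rewrite -{1}(divq_num_den x) -{1}(divq_num_den y) mulf_div -!rmorphM /=.
rewrite padic_abs_frac ?mulf_neq0 ?numq_eq0 ?denq_neq0 //.
rewrite /padic_abs (negbTE x0) (negbTE y0) !abszM.
rewrite !lognM ?absz_gt0 ?numq_eq0 ?denq_neq0 //.
have [pp|np] := boolP (prime p).
  by rewrite -expfzDr ?pnatr_eq0 -?lt0n ?prime_gt0 // !PoszD; congr (_ ^ _); ring.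
by rewrite !logn_nonprime // addn0 subrr !expr0z mulr1.
Qed.

Lemma padic_absN x : |<- x>| = |<x>|.
Proof. by rewrite /padic_abs oppr_eq0 numqN denqN abszN. Qed.

Lemma padic_abs_distC x y : |<x - y>| = |<y - x>|.
Proof. by rewrite -padic_absN opprB. Qed.

Lemma padic_abs1 : |<1>| = 1.
Proof. by rewrite /padic_abs oner_eq0 /= logn1 subrr expr0z. Qed.

Lemma padic_absV x : |<x^-1>| = |<x>|^-1.
Proof.
have [->|x0] := eqVneq x 0; first by rewrite !(invr0, padic_abs0).
apply: (mulfI (_ : |<x>| != 0)); first by rewrite padic_abs_eq0.
by rewrite -padic_absM !mulfV ?padic_abs1 // padic_abs_eq0.
Qed.

Lemma padic_absD x y : |<x + y>| <= Num.max |<x>| |<y>|.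
Proof.
have [->|x0] := eqVneq x 0; first by rewrite add0r le_max lexx orbT.
have [->|y0] := eqVneq y 0; first by rewrite addr0 le_max lexx.
have [->|xy0] := eqVneq (x + y) 0.
  by rewrite padic_abs0 le_max padic_abs_ge0.
have [pp|np] := boolP (prime p); last first.
  rewrite /padic_abs (negbTE x0) (negbTE y0) (negbTE xy0).
  by rewrite !logn_nonprime // subrr expr0z le_max lexx.
have dx0 : (denq x)%:Q != 0 by rewrite intr_eq0 denq_neq0.
have dy0 : (denq y)%:Q != 0 by rewrite intr_eq0 denq_neq0.
pose d := denq x * denq y; pose m := numq x * denq y; pose n := numq y * denq x.
have d0 : d != 0 by rewrite mulf_neq0 // denq_neq0.
have ex : x = m%:Q / d%:Q.
  by rewrite /m /d -{1}(divq_num_den x) !rmorphM /=; field; rewrite dx0 dy0.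
have ey : y = n%:Q / d%:Q.
  by rewrite /n /d -{1}(divq_num_den y) !rmorphM /=; field; rewrite dx0 dy0.
have exy : x + y = (m + n)%:Q / d%:Q by rewrite ex ey -mulrDl rmorphD.
have m0 : m != 0 by rewrite mulf_neq0 ?numq_eq0 ?denq_neq0.
have n0 : n != 0 by rewrite mulf_neq0 ?numq_eq0 ?denq_neq0.
have mn0 : m + n != 0.
  by apply: contra_neq xy0 => h; rewrite exy h mul0r.
rewrite exy ex ey !padic_abs_frac //.
have p1 : 1 <= p%:R :> rat by rewrite ler1n prime_gt0.
set k := minn (logn p `|m|) (logn p `|n|).
have hk : (k <= logn p `|(m + n)%R|)%N.
  rewrite -pfactor_dvdn ?absz_gt0 //.
  suff : (((p ^ k)%N : int) %| m + n)%Z by rewrite dvdzE.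
  by rewrite rpredD // dvdzE /= pfactor_dvdn ?absz_gt0 // /k ?geq_minl ?geq_minr.
have : (logn p `|d|)%:Z - (logn p `|(m + n)%R|)%:Z <= (logn p `|d|)%:Z - k%:Z.
  by rewrite lerD2l lerN2 lez_nat.
move=> /(ler_weXz2l p1) /le_trans; apply.
by rewrite /k /minn; case: ifP => _; rewrite le_max lexx ?orbT.
Qed.

Lemma padic_absB x y : |<x - y>| <= Num.max |<x>| |<y>|.
Proof. by rewrite -[|<y>|]padic_absN padic_absD. Qed.

Definition padic_cauchy : {pred nat -> rat} := fun u =>
  `[< forall e : rat, 0 < e ->
      exists N, forall m n, (N <= m)%N -> (N <= n)%N -> |<u m - u n>| < e >].

Definition padic_null : {pred nat -> rat} := fun u =>
  `[< forall e : rat, 0 < e -> exists N, forall n, (N <= n)%N -> |<u n>| < e >].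

Lemma padic_cauchyP u : reflect (forall e : rat, 0 < e ->
  exists N, forall m n, (N <= m)%N -> (N <= n)%N -> |<u m - u n>| < e)
  (u \in padic_cauchy).
Proof. exact: asboolP. Qed.

Lemma padic_nullP u : reflect
  (forall e : rat, 0 < e -> exists N, forall n, (N <= n)%N -> |<u n>| < e)
  (u \in padic_null).
Proof. exact: asboolP. Qed.

Lemma padic_cauchy_bounded u : u \in padic_cauchy ->
  exists2 B, 0 < B & exists N, forall n, (N <= n)%N -> |<u n>| <= B.
Proof.
move=> /padic_cauchyP /(_ 1 ltr01)[N hN].
exists (Num.max 1 |<u N>|); first by rewrite lt_max ltr01.
exists N => n Nn; rewrite -[u n](subrK (u N)) (le_trans (padic_absD _ _)) //.
by rewrite ge_max !le_max lexx orbT andbT ltW // hN.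
Qed.

Lemma padic_cauchy_subring : subring_closed padic_cauchy.
Proof.
split=> [|u v /padic_cauchyP hu /padic_cauchyP hv|u v].
- apply/padic_cauchyP => e e0; exists 0%N => m n _ _.
  by rewrite subrr padic_abs0.
- apply/padic_cauchyP => e e0.
  have [N hN] := hu _ e0; have [M hM] := hv _ e0.
  exists (maxn N M) => m n; rewrite !geq_max => /andP[Nm Mm] /andP[Nn Mn].
  rewrite (_ : (u - v) m - _ = (u m - u n) - (v m - v n)); last first.
    by rewrite -[(u - v) m]/(u m - v m) -[(u - v) n]/(u n - v n); ring.
  by rewrite (le_lt_trans (padic_absB _ _)) // gt_max hN // hM.
- move=> cu cv; have [A A0 [NA hA]] := padic_cauchy_bounded cu.
  have [B B0 [NB hB]] := padic_cauchy_bounded cv.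
  move: cu cv => /padic_cauchyP hu /padic_cauchyP hv.
  apply/padic_cauchyP => e e0.
  have [N hN] := hu _ (divr_gt0 e0 B0); have [M hM] := hv _ (divr_gt0 e0 A0).
  exists (maxn (maxn NA NB) (maxn N M)) => m n; rewrite !geq_max.
  move=> /andP[/andP[Am Bm] /andP[Nm Mm]] /andP[/andP[An Bn] /andP[Nn Mn]].
  rewrite (_ : (u * v) m - _ = u m * (v m - v n) + (u m - u n) * v n); last first.
    by rewrite -[(u * v) m]/(u m * v m) -[(u * v) n]/(u n * v n); ring.
  rewrite (le_lt_trans (padic_absD _ _)) // gt_max !padic_absM.
  apply/andP; split.
    rewrite (le_lt_trans (ler_wpM2r (padic_abs_ge0 _) (hA _ Am))) //.
    by rewrite mulrC -ltr_pdivlMr // hM.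
  rewrite (le_lt_trans (ler_wpM2l (padic_abs_ge0 _) (hB _ Bn))) //.
  by rewrite -ltr_pdivlMr // hN.
Qed.

HB.instance Definition _ :=
  GRing.isSubringClosed.Build (nat -> rat) padic_cauchy padic_cauchy_subring.

Definition padic_seq := {u : nat -> rat | u \in padic_cauchy}.
HB.instance Definition _ := SubType.on padic_seq.
HB.instance Definition _ := Choice.on padic_seq.
HB.instance Definition _ := [SubChoice_isSubComNzRing of padic_seq by <:].

Definition padic_nulls : {pred padic_seq} := fun u => val u \in padic_null.

Lemma padic_nulls_ideal : idealr_closed padic_nulls.
Proof.
split=> [||[a ca] [u cu] [v cv] /padic_nullP /= hu /padic_nullP /= hv].
- by apply/padic_nullP => e e0; exists 0%N => n _; rewrite /= padic_abs0.
- apply/negP => /padic_nullP /(_ 1 ltr01)[N /(_ N (leqnn _))].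
  by rewrite /= padic_abs1 ltxx.
- apply/padic_nullP => e e0.
  have [A A0 [NA hA]] := padic_cauchy_bounded ca.
  have [N hN] := hu _ (divr_gt0 e0 A0); have [M hM] := hv _ e0.
  exists (maxn NA (maxn N M)) => n; rewrite !geq_max => /and3P[An Nn Mn].
  rewrite /= [X in |<X>|]/(a n * u n + v n).
  rewrite (le_lt_trans (padic_absD _ _)) // gt_max hM // andbT padic_absM.
  rewrite (le_lt_trans (ler_wpM2r (padic_abs_ge0 _) (hA _ An))) //.
  by rewrite mulrC -ltr_pdivlMr // hN.
Qed.

HB.instance Definition _ :=
  isIdealr.Build padic_seq padic_nulls padic_nulls_ideal.

(* the completion of rat for |.|_p: Cauchy sequences modulo null sequences  *)
Definition Qp := {ideal_quot padic_nulls}.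
HB.instance Definition _ := GRing.ComNzRing.on Qp.
HB.instance Definition _ := EqQuotient.on Qp.

Lemma padic_not_null (u : nat -> rat) :
  u \in padic_cauchy -> u \notin padic_null ->
  exists2 d, 0 < d & exists N, forall n, (N <= n)%N -> d <= |<u n>|.
Proof.
move=> /padic_cauchyP cu nu.
have [d [d0 hd]] : exists d : rat, 0 < d /\
    forall N, exists2 n, (N <= n)%N & d <= |<u n>|.
  apply: contrapT => h; move/negP: nu; apply; apply/padic_nullP => e e0.
  apply: contrapT => h'; apply: h; exists e; split=> // N.
  apply: contrapT => h''; apply: h'; exists N => n Nn.
  by rewrite ltNge; apply/negP => h; apply: h''; exists n.
exists d => //; have [N hN] := cu _ d0; exists N => n Nn.
have [m Nm dm] := hd N; rewrite leNgt; apply/negP => hlt.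
suff : |<u m>| < d by rewrite ltNge dm.
rewrite -[u m](subrK (u n)) (le_lt_trans (padic_absD _ _)) //.
by rewrite gt_max hlt andbT hN.
Qed.

Lemma padic_cauchyV (u : nat -> rat) :
  u \in padic_cauchy -> u \notin padic_null ->
  (fun n => (u n)^-1) \in padic_cauchy.
Proof.
move=> cu nu; have [d d0 [N0 hd]] := padic_not_null cu nu.
apply/padic_cauchyP => e e0; move/padic_cauchyP : cu => cu.
have [N hN] := cu _ (mulr_gt0 e0 (mulr_gt0 d0 d0)).
exists (maxn N0 N) => m n; rewrite !geq_max => /andP[m0 mN] /andP[n0 nN].
have h k : (N0 <= k)%N -> 0 < |<u k>| by move=> /hd; exact: lt_le_trans.
have um : u m != 0 by rewrite -padic_abs_eq0 gt_eqF // h.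
have un : u n != 0 by rewrite -padic_abs_eq0 gt_eqF // h.
rewrite (_ : _ - _ = (u n - u m) / (u m * u n)); last by field; rewrite um un.
rewrite padic_absM padic_absV ltr_pdivrMr padic_absM ?mulr_gt0 ?h //.
rewrite (lt_le_trans (hN _ _ nN mN)) // ler_pM2l //.
by rewrite ler_pM ?(ltW d0) ?hd.
Qed.

(* Termwise inversion preserves Cauchyness only for non-null sequences; the   *)
(* default value 0 of insubd is never used (padic_cauchyV).                   *)
Definition padic_inv (x : Qp) : Qp :=
  if x == 0 then 0 else \pi_Qp%qT (insubd 0 (fun n => (val (repr x) n)^-1)).

Lemma padic_reprN0 (x : Qp) : x != 0 -> val (repr x) \notin padic_null.
Proof.
apply: contra => h; rewrite -[x]reprK; apply/eqP.
have /eqP -> : \pi_Qp%qT (repr x) == \pi_Qp%qT 0 by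
  rewrite -Quotient.idealrBE subr0.
exact: pi_zeror.
Qed.

Lemma padic_mulVf (x : Qp) : x != 0 -> padic_inv x * x = 1.
Proof.
move=> x0; rewrite /padic_inv (negbTE x0).
have nx := padic_reprN0 x0; have cx := valP (repr x).
set v : padic_seq := insubd _ _.
have ev : val v = (fun n => (val (repr x) n)^-1).
  by rewrite val_insubd padic_cauchyV.
rewrite -[in X in _ * X](reprK x).
suff /eqP : \pi_Qp%qT (v * repr x) == \pi_Qp%qT 1 by rewrite pi_mulr pi_oner.
rewrite -Quotient.idealrBE.
have [d d0 [N hd]] := padic_not_null cx nx.
apply/padic_nullP => e e0; exists N => n Nn.
rewrite (_ : val _ n = (val v n) * val (repr x) n - 1) // ev.
rewrite mulVf ?subrr ?padic_abs0 // -padic_abs_eq0 gt_eqF //.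
exact: lt_le_trans (hd _ Nn).
Qed.

Lemma padic_inv0 : padic_inv 0 = 0. Proof. by rewrite /padic_inv eqxx. Qed.

HB.instance Definition _ :=
  GRing.ComNzRing_isField.Build Qp padic_mulVf padic_inv0.

End PadicAbs.

(* |.|_p extended from rat to Qp by continuity, with values in R; the choice  *)
(* of the representative is irrelevant, see padic_norm_pi.                    *)
Definition padic_norm (R : realType) (p : nat) (x : Qp p) : R :=
  lim ((fun n => ratr (padic_abs p (val (repr x) n)) : R) @ \oo).

Section PadicNorm.
Variables (R : realType) (p : nat).
Local Notation "|< x >|" := (padic_abs p x) (at level 0, format "|< x >|").
Local Notation norm := (@padic_norm R p).
Implicit Types (u v : padic_seq p) (x y : Qp p).

Lemma padic_abs_lip (a b : rat) : `| |<a>| - |<b>| | <= |<a - b>|.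
Proof.
suff h (c d : rat) : |<c>| - |<d>| <= |<c - d>|.
  by rewrite ler_norml h andbT lerNl opprB padic_abs_distC h.
rewrite lerBlDr -{1}[c](subrK d) (le_trans (padic_absD _ _ _)) //.
by rewrite ge_max lerDl lerDr !padic_abs_ge0.
Qed.

Lemma ratr_abs_lip (a b : rat) :
  `| ratr |<a>| - ratr |<b>| | <= ratr |<a - b>| :> R.
Proof. by rewrite -rmorphB -ratr_norm ler_rat padic_abs_lip. Qed.

Lemma rat_pos_lt (e : R) : 0 < e -> exists2 q : rat, 0 < q & ratr q < e.
Proof.
by move=> /rat_in_itvoo[q]; rewrite in_itv /= ltr0q => /andP[]; exists q.
Qed.

Lemma padic_abs_is_cvg u : cvg ((fun n => ratr |<val u n>| : R) @ \oo).
Proof.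
apply/cauchy_cvgP/cauchy_exP => e /rat_pos_lt[q q0 qe].
have /padic_cauchyP/(_ _ q0)[N hN] := valP u.
exists (ratr |<val u N>|).
suff : \forall n \near \oo, `|ratr |<val u N>| - ratr |<val u n>| | < e by [].
near=> n.
rewrite (le_lt_trans (ratr_abs_lip _ _)) // (lt_trans _ qe) // ltr_rat.
by rewrite hN //; near: n; exact: nbhs_infty_ge.
Unshelve. all: by end_near. Qed.

Lemma padic_norm_pi u :
  (fun n => ratr |<val u n>| : R) @ \oo --> norm (\pi_(Qp p)%qT u).
Proof.
rewrite /padic_norm; set w := repr _.
have /padic_nullP h : val (u - w) \in @padic_null p.
  have : u - w \in @padic_nulls p.
    by rewrite Quotient.idealrBE /w reprK.
  by [].
apply: (cvg_sub0 (g := fun n => ratr |<val w n>| : R)); last exact: padic_abs_is_cvg.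
apply/cvgr0Pnorm_lt => e /rat_pos_lt[q q0 qe]; have [N hN] := h _ q0.
near=> n; rewrite (le_lt_trans (ratr_abs_lip _ _)) // (lt_trans _ qe) // ltr_rat.
by apply: hN; near: n; exact: nbhs_infty_ge.
Unshelve. all: by end_near. Qed.

Lemma padic_normE x u : x = \pi_(Qp p)%qT u ->
  norm x = lim ((fun n => ratr |<val u n>| : R) @ \oo).
Proof. by move=> ->; apply/esym/cvg_lim => //; exact: padic_norm_pi. Qed.

Lemma padic_norm_ge0 x : 0 <= norm x.
Proof.
apply: limr_ge; first exact: padic_abs_is_cvg.
by near=> n; rewrite ler0q padic_abs_ge0.
Unshelve. all: by end_near. Qed.

Lemma padic_norm0 : norm 0 = 0.
Proof.
have e : 0 = \pi_(Qp p)%qT 0 by rewrite pi_zeror.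
rewrite (padic_normE e).
rewrite (_ : (fun _ => _) = cst 0) ?lim_cst //.
by apply/funext => n /=; rewrite padic_abs0 rmorph0.
Qed.

Lemma padic_norm_eq0 x : (norm x == 0) = (x == 0).
Proof.
have [->|x0] := eqVneq x 0; first by rewrite padic_norm0 eqxx.
rewrite gt_eqF //.
have [d d0 [N hN]] := padic_not_null (valP (repr x)) (padic_reprN0 x0).
apply: (@lt_le_trans _ _ (ratr d)); first by rewrite ltr0q.
apply: limr_ge; first exact: padic_abs_is_cvg.
by near=> n; rewrite ler_rat hN //; near: n; exact: nbhs_infty_ge.
Unshelve. all: by end_near. Qed.

Lemma padic_normM x y : norm (x * y) = norm x * norm y.
Proof.
rewrite -[x]reprK -[y]reprK -pi_mulr.
apply: (cvg_unique _ (@padic_norm_pi _)) => //.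
rewrite (_ : (fun _ => _) =
  (fun n => ratr |<val (repr x) n>| * ratr |<val (repr y) n>|)).
  by apply: cvgM; exact: padic_norm_pi.
by apply/funext => n; rewrite -rmorphM -padic_absM.
Qed.

Lemma padic_normD x y : norm (x + y) <= Num.max (norm x) (norm y).
Proof.
rewrite -[x]reprK -[y]reprK -pi_addr.
set u := repr x; set v := repr y.
have h : (fun n => Num.max (ratr |<val u n>|) (ratr |<val v n>|) : R) @ \oo -->
    Num.max (norm (\pi_(Qp p)%qT u)) (norm (\pi_(Qp p)%qT v)).
  rewrite maxr_absE; under eq_fun do rewrite maxr_absE.
  apply: cvgM; last exact: cvg_cst.
  apply: cvgD; first by apply: cvgD; exact: padic_norm_pi.
  by apply: cvg_norm; apply: cvgB; exact: padic_norm_pi.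
apply: (ler_cvg_to (@padic_norm_pi _) h); near=> n.
have := padic_absD p (val u n) (val v n).
by rewrite !le_max !ler_rat.
Unshelve. all: by end_near. Qed.

Lemma padic_norm_nat (n : nat) : norm n%:R = ratr |<n%:R>|.
Proof.
have e : n%:R = \pi_(Qp p)%qT n%:R.
  by elim: n => [|n IH]; rewrite ?pi_zeror // -!natr1 pi_addr IH pi_oner.
rewrite (padic_normE e) (_ : (fun _ => _) = cst (ratr |<n%:R>|)) ?lim_cst //.
apply/funext => k /=; congr (ratr |<_>|).
by elim: n {e} => [//|n IH]; rewrite -!natr1 -IH.
Qed.

Lemma padic_norm_p : prime p -> norm p%:R = p%:R^-1.
Proof.
move=> pp; rewrite padic_norm_nat.
have p0 : (p : int) != 0 by rewrite -lt0n prime_gt0.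
have -> : p%:R = (p : int)%:Q / 1%:Q :> rat by rewrite divr1.
rewrite padic_abs_frac // logn1 logn_prime // eqxx sub0r.
by rewrite -invr_expz expr1z fmorphV /= ratr_nat.
Qed.

End PadicNorm.

Definition padic_value (R : realType) (p : nat) (r : R) : Prop :=
  exists k : int, r = p%:R ^ k.

Definition padic_sphere (R : realType) (p : nat) (x0 : Qp p) (r : R) :
  set (Qp p) := [set x | padic_norm R (x - x0) = r].

(* f(V) `<=` V for a map f with domain of definition D; the values of the     *)
(* total function f outside D are ignored.                                    *)
Definition invariant_set (T : Type) (D : set T) (f : T -> T) (V : set T) :
  Prop := f @` (V `&` D) `<=` V.

(* Only meaningful for x != - c, as x / 0 = 0.                                *)
Definition quad_frac (K : fieldType) (a b c x : K) : K :=
  (x ^+ 2 + a * x + b) / (x + c).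

Lemma quad_frac_fixed (K : fieldType) (a b c : K) : a != c ->
  c ^+ 2 - a * c + b != 0 ->
  forall x, x != - c -> quad_frac a b c x = x <-> x = b / (c - a).
Proof.
move=> ac hb x xc.
have ca0 : c - a != 0 by rewrite subr_eq0 eq_sym.
have xc0 : x + c != 0 by rewrite addr_eq0.
rewrite /quad_frac; split=> [h|->].
  have : x * (x + c) = x ^+ 2 + a * x + b by rewrite -{1}h divfK.
  move=> e; apply: (mulIf ca0); rewrite divfK //.
  have -> : x * (c - a) = x * (x + c) - x ^+ 2 - a * x by ring.
  by rewrite e; ring.
field; rewrite ca0 /=.
by rewrite (_ : b + c * _ = c ^+ 2 - a * c + b); last ring.
Qed.

Definition I1 (R : realType) (alpha beta : R) : set R :=
  if alpha != beta then [set r | 0 < r /\ Num.max alpha beta < r] else set0.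

Definition I2 (R : realType) (alpha beta : R) : set R :=
  if alpha == beta then [set r | 0 < r /\ r != beta] else set0.

Definition I12 (R : realType) (alpha beta : R) : set R :=
  I1 alpha beta `|` I2 alpha beta.

(* Main.v *)
(* With y = x - x0, A = x0 + a and B = x0 + c one has
   f x - x0 = y (y + A) / (y + B), so S_r(x0) is invariant iff
   |y + A| = |y + B| whenever |y| = r and y != - B.  The strong triangle
   inequality gives these norms as soon as r is neither |A| nor |B|; at r = |A|
   the point y = - A is sent to x0, and at r = |B| the point y = - B + p B,
   close to the pole, decides. *)
Require Import Defs.
From mathcomp Require Import all_boot all_order all_algebra.
From mathcomp Require Import boolp classical_sets functions reals topology normedtype sequences.
From mathcomp Require Import ring.

Set Implicit Arguments.
Unset Strict Implicit.
Unset Printing Implicit Defensive.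

Import Order.TTheory GRing.Theory Num.Theory.

Local Open Scope classical_set_scope.
Local Open Scope ring_scope.

Section PadicNormTheory.
Variables (R : realType) (p : nat).
Local Notation norm := (@padic_norm R p).
Implicit Types x y : Qp p.

Lemma padic_norm1 : norm 1 = 1.
Proof. by rewrite (padic_norm_nat R p 1) padic_abs1 rmorph1. Qed.

Lemma padic_normN x : norm (- x) = norm x.
Proof.
(* Nonnegative reals with equal squares agree, and [- x] and [x] have the same square. *)
by apply/eqP; rewrite -(@eqrXn2 _ 2) ?padic_norm_ge0 // !expr2 -!padic_normM mulrNN.
Qed.

Lemma padic_normV x : norm x^-1 = (norm x)^-1.
Proof.
have [->|x0] := eqVneq x 0; first by rewrite invr0 padic_norm0 invr0.
apply: (mulfI (_ : norm x != 0)); first by rewrite padic_norm_eq0.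
by rewrite -padic_normM !divff ?padic_norm1 // padic_norm_eq0.
Qed.

Lemma padic_normXz x (k : int) : norm (x ^ k) = norm x ^ k.
Proof.
have normX n : norm (x ^+ n) = norm x ^+ n.
  by elim: n => [|n IHn]; rewrite ?expr0 ?padic_norm1 // !exprS padic_normM IHn.
by case: k => n; rewrite ?NegzE -?exprnP -?exprnN ?padic_normV normX.
Qed.

Lemma padic_normD_lt x y : norm x < norm y -> norm (x + y) = norm y.
Proof.
move=> xy; apply/eqP; rewrite eq_le; apply/andP; split.
  by have := padic_normD R x y; rewrite (max_r (ltW xy)).
(* As [y = (x + y) - x], [norm y] is at most [norm (x + y)] or [norm x]; the latter contradicts
   [xy]. *)
have := padic_normD R (x + y) (- x).
by rewrite addrAC subrr add0r padic_normN le_max leNgt [_ <= norm x]leNgt xy orbF -leNgt.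
Qed.

Lemma padic_value_norm (r : R) : prime p -> padic_value p r ->
  exists y, norm y = r.
Proof.
(* The sign of the exponent flips because [p] has norm [p^-1]. *)
move=> p_prime [k ->]; exists (p%:R ^ (- k)).
by rewrite padic_normXz padic_norm_p // exprz_inv opprK.
Qed.

Lemma padic_norm_p_lt1 : prime p -> norm p%:R < 1.
Proof.
by move=> pp; rewrite padic_norm_p // invf_lt1 ?ltr1n ?ltr0n ?prime_gt1 ?prime_gt0.
Qed.

End PadicNormTheory.

Lemma quad_frac_shift (K : fieldType) (a b c y : K) (x0 := b / (c - a)) :
  a != c -> y + (x0 + c) != 0 ->
  quad_frac a b c (y + x0) - x0 = y * (y + (x0 + a)) / (y + (x0 + c)).
Proof.
move=> ac; rewrite addrA => h.
have e : b = x0 * (c - a) by rewrite divfK // subr_eq0 eq_sym.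
by apply: (mulIf h); rewrite mulrBl !divfK // e; ring.
Qed.

(** By [quad_frac_shift], the image of [y + x0] lies at distance [r * |y + A| / |y + B|] from [x0];
    cancel [r], which is nonzero. *)
Lemma invariant_sphereE (R : realType) (p : nat) (a b c : Qp p) (r : R)
    (x0 := b / (c - a)) : a != c -> 0 < r ->
  invariant_set [set x | x != - c] (quad_frac a b c) (padic_sphere x0 r) <->
  forall y, padic_norm R y = r -> y + (x0 + c) != 0 ->
    padic_norm R (y + (x0 + a)) = padic_norm R (y + (x0 + c)).
Proof.
move=> ac r0.
have key y : padic_norm R y = r -> y + (x0 + c) != 0 ->
    padic_norm R (quad_frac a b c (y + x0) - x0) = r <->
    padic_norm R (y + (x0 + a)) = padic_norm R (y + (x0 + c)).
  move=> yr yB; rewrite quad_frac_shift // !padic_normM padic_normV yr.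
  have B0 : padic_norm R (y + (x0 + c)) != 0 by rewrite padic_norm_eq0.
  split=> [h|->]; last by rewrite mulfK.
  by apply: (mulfI (lt0r_neq0 r0)); rewrite -[in RHS]h divfK.
split=> [inv y yr yB|h _ [x [xr xc] <-]].
- apply: (proj1 (key y yr yB)).
  have : padic_sphere x0 r (quad_frac a b c (y + x0)); last by [].
  apply: inv; exists (y + x0); last by [].
  split; first by rewrite /padic_sphere /= addrK.
  by rewrite /= -addr_eq0 -addrA.
- have yB : (x - x0) + (x0 + c) != 0 by rewrite addrA subrK addr_eq0.
  have := proj2 (key (x - x0) xr yB) (h (x - x0) xr yB).
  by rewrite subrK.
Qed.

(** Used to show that the fixed point is not the pole, hence [beta > 0]. *)
Lemma quad_frac_fixed_addr (K : fieldType) (a b c : K) : a != c ->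
  b / (c - a) + c = (c ^+ 2 - a * c + b) / (c - a).
Proof. by move=> ac; field; rewrite subr_eq0 eq_sym. Qed.

Theorem corollary1 (R : realType) (p : nat) (p_prime : prime p)
    (a b c : Qp p) (a_neq_c : a != c) (x0_neq_pole : c ^+ 2 - a * c + b != 0)
    (r : R) (r_gt0 : 0 < r) (r_value : padic_value p r) :
  let x0 := b / (c - a) in
  let alpha := padic_norm R (x0 + a) in
  let beta := padic_norm R (x0 + c) in
  invariant_set [set x | x != - c] (quad_frac a b c) (padic_sphere x0 r)
  <-> I12 alpha beta r.
Proof.
move=> x0 alpha beta.
rewrite invariant_sphereE // -/x0.
set A := x0 + a in alpha *; set B := x0 + c in beta *.
have B0 : B != 0.
  rewrite /B /x0 (quad_frac_fixed_addr _ a_neq_c) mulf_eq0 negb_or x0_neq_pole.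
  by rewrite invr_eq0 subr_eq0 eq_sym a_neq_c.
have beta_gt0 : 0 < beta by rewrite lt0r padic_norm_eq0 B0 padic_norm_ge0.
have AB : A != B by rewrite (inj_eq (addrI x0)).
clearbody A B.
have norm_gt y z : padic_norm R z < padic_norm R y ->
    padic_norm R (y + z) = padic_norm R y.
  by rewrite addrC; exact: padic_normD_lt.
split=> [h|[]].
- have r_alpha : r != alpha.
    (* At [y = - A] the left norm vanishes, which would force [B = A]. *)
    apply/negP => /eqP ra; have := h (- A).
    rewrite padic_normN ra addNr padic_norm0 addrC subr_eq0 eq_sym => /(_ erefl AB).
    by move/esym/eqP; rewrite padic_norm_eq0 subr_eq0 eq_sym (negbTE AB).
  have [ab|ab] := eqVneq alpha beta.
    by right; rewrite /I2 ab eqxx /=; rewrite -ab.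
  left; rewrite /I1 ab /=; split=> //.
  (* One test point refutes all [r <= max alpha beta]. If [r != beta], any point of norm [r] avoids
     [- B]; if [r = beta], take [p B - B], for which [|y + B| = |p B| < beta]. *)
  have [y [yr yB0 yB]] : exists y, [/\ padic_norm R y = r, y + B != 0 &
      r = beta -> padic_norm R (y + B) < beta].
    have [rb|rb] := eqVneq r beta; last first.
      have [y yr] := padic_value_norm p_prime r_value.
      exists y; split; [exact: yr | | by move=> /eqP; rewrite (negbTE rb)].
      apply: contra_neq rb; rewrite -yr => /eqP; rewrite addr_eq0 => /eqP ->.
      by rewrite padic_normN.
    have pB : padic_norm R (p%:R * B) < beta.
      by rewrite padic_normM gtr_pMl ?padic_norm_p_lt1.
    exists (p%:R * B - B); rewrite subrK; split; last by [].
      by rewrite padic_normD_lt padic_normN.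
    rewrite mulf_eq0 negb_or B0 andbT -(padic_norm_eq0 R) padic_norm_p //.
    by rewrite invr_eq0 pnatr_eq0 -lt0n prime_gt0.
  rewrite ltNge; apply/negP => r_le.
  have {}h := h y yr yB0.
  case: (ltgtP alpha beta) ab r_le => // [ab|ba] _ r_le.
  (* If [r = beta], then [|y + A| = r = beta > |y + B|]. If [r < beta], then [|y + B| = beta]
     exceeds [max r alpha], a bound for [|y + A|]. *)
  + have := r_le; rewrite le_eqVlt => /predU1P[rb|rb].
      by move: (yB rb); rewrite -h norm_gt yr rb // ltxx.
    have := padic_normD R y A.
    by rewrite h padic_normD_lt yr // leNgt gt_max rb ab.
  (* Here [|y + A| = alpha] exceeds [max r beta], a bound for [|y + B|]. *)
  + have ra : r < alpha by rewrite lt_neqAle r_alpha.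
    have := padic_normD R y B.
    by rewrite -h padic_normD_lt yr // leNgt gt_max ra ba.
- rewrite /I1; case: ifP => // _ [_]; rewrite gt_max => /andP[ra rb] y yr _.
  by rewrite !norm_gt ?yr.
(* Both norms equal the common value [alpha = beta] when [r] is below it, and [r] when above. *)
- rewrite /I2; case: eqP => // ab [_]; rewrite neq_lt => /orP[rb|rb] y yr _.
    by rewrite !padic_normD_lt ?yr // -/alpha ab.
  by rewrite !norm_gt ?yr // -/alpha ab.
Qed.
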